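(* Let the ground field be $\mathbb{C}$. Let $$B=\begin{pmatrix}0&0&0&0\\ 0&0&0&0\\ 0&0&0&0\\ 1&1&0&0\end{pmatrix},\quad B'=\begin{pmatrix}0&0&0&0\\ 0&0&0&0\\ 0&0&0&0\\ 1&1&1&0\end{pmatrix},\quad D_1=\begin{pmatrix}0&0&0&0\\ 0&0&0&0\\ 1&1&0&0\\ 1&1&0&0\end{pmatrix},\quad C_z=\begin{pmatrix}0&0&0&0\\ 0&0&0&0\\ 1&1&0&0\\ z&0&1&0\end{pmatrix}\ (z\in\mathbb{C}),$$ let $0_4$ be the $4\times 4$ zero matrix, and let $$\mathcal{U}=\left\{z\in\mathbb{C}:\left|z+\tfrac12\right|<\tfrac12\right\}\cup\left\{z\in\mathbb{C}:\left|z+\tfrac12\right|=\tfrac12\text{ and }\operatorname{Im}(z)\geq 0\right\}.$$ Then the set of matrices $$\{0_4,B,B',D_1\}\cup\{C_z:z\in\mathcal{U}\}$$ is a complete set of representatives of (pairwise different) $\sim$-classes for $\mathcal{TM}_4$ over $\mathbb{C}$; that is, every matrix in $\mathcal{TM}_4$ is $\sim$-equivalent to exactly one matrix of this set.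
   Context: $\mathcal{TM}_4$ denotes the set of all strictly lower triangular $4\times 4$ matrices with entries in the ground field $\mathbb{F}$ (here $\mathbb{F}=\mathbb{C}$). For a strictly lower triangular $n\times n$ matrix $T=[t_{ij}]$ ($n\geq 2$), $\mathcal{A}(T)$ is the commutative (unital, associative) $\mathbb{F}$-algebra given by generators $X_1,\dots,X_n$ and relations $X_1^2=0$ and $X_i^2=\sum_{j<i}t_{ij}X_jX_i$ for $2\leq i\leq n$; it is graded by $\deg(X_i)=2$. For two such $n\times n$ matrices write $T\sim S$ if there is a degree preserving isomorphism of graded $\mathbb{F}$-algebras $\mathcal{A}(T)\to\mathcal{A}(S)$. *)

(* Defs.v *)
From HB Require Import structures.
From mathcomp Require Import all_boot all_order all_algebra.
From mathcomp Require Import generic_quotient ring_quotient.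
From mathcomp Require Import mpoly.
From mathcomp Require Import boolp reals complex.

Set Implicit Arguments.
Unset Strict Implicit.
Unset Printing Implicit Defensive.

Import Order.TTheory GRing.Theory Num.Theory.
Local Open Scope ring_scope.
Local Open Scope quotient_scope.

Section Algebra.
Variables (F : fieldType) (n : nat).

Definition strictly_lower_triangular (T : 'M[F]_n) : Prop :=
  forall i j : 'I_n, (i <= j)%N -> T i j = 0.

(* For the first generator the sum is empty, so its relator is its square. *)
Definition relator (T : 'M[F]_n) (i : 'I_n) : {mpoly F[n]} :=
  'X_i ^+ 2 - \sum_(j < n | (j < i)%N) T i j *: ('X_j * 'X_i).

Definition in_rel_ideal (T : 'M[F]_n) (p : {mpoly F[n]}) : Prop :=
  exists h : 'I_n -> {mpoly F[n]}, p = \sum_(i < n) h i * relator T i.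

Definition rel_ideal (T : 'M[F]_n) : {pred {mpoly F[n]}} :=
  fun p => `[< in_rel_ideal T p >].

Lemma rel_ideal_closed (T : 'M[F]_n) : idealr_closed (rel_ideal T).
Proof.
split.
- by apply/asboolP; exists (fun=> 0); rewrite big1 // => i _; rewrite mul0r.
- apply/negP => /asboolP [h /(congr1 (meval (fun=> 0)))].
  rewrite rmorph1 rmorph_sum /= big1 => [|i _].
    by move/eqP; rewrite oner_eq0.
  rewrite rmorphM /relator rmorphB rmorphXn /= mevalXU expr0n /= rmorph_sum /=.
  rewrite big1 ?subr0 ?mulr0 // => j _.
  by rewrite mevalZ rmorphM /= !mevalXU !mulr0.
- move=> a u v /asboolP [h ->] /asboolP [k ->]; apply/asboolP.
  exists (fun i => a * h i + k i).
  by rewrite mulr_sumr -big_split /=; apply: eq_bigr => i _; rewrite mulrDl mulrA.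
Qed.

HB.instance Definition _ (T : 'M[F]_n) :=
  isIdealr.Build {mpoly F[n]} (rel_ideal T) (rel_ideal_closed T).

Definition alg_of (T : 'M[F]_n) : Type := {ideal_quot (rel_ideal T)}.

HB.instance Definition _ (T : 'M[F]_n) := GRing.ComNzRing.on (alg_of T).

Definition alg_pi (T : 'M[F]_n) (p : {mpoly F[n]}) : alg_of T :=
  \pi_{ideal_quot (rel_ideal T)} p.

Definition alg_scale (T : 'M[F]_n) (c : F) (x : alg_of T) : alg_of T :=
  alg_pi T c%:MP * x.

Lemma alg_piD T : {morph alg_pi T : p q / p + q}.
Proof. exact: (rmorphD \pi_{ideal_quot (rel_ideal T)}). Qed.

Lemma alg_piM T : {morph alg_pi T : p q / p * q}.
Proof. exact: (rmorphM \pi_{ideal_quot (rel_ideal T)}). Qed.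

Lemma alg_pi1 T : alg_pi T 1 = 1.
Proof. exact: (rmorph1 \pi_{ideal_quot (rel_ideal T)}). Qed.

Lemma alg_scaleA T a b (x : alg_of T) :
  alg_scale a (alg_scale b x) = alg_scale (a * b) x.
Proof. by rewrite /alg_scale mulrA -alg_piM mpolyCM. Qed.

Lemma alg_scale1 T : left_id 1 (@alg_scale T).
Proof. by move=> x; rewrite /alg_scale mpolyC1 alg_pi1 mul1r. Qed.

Lemma alg_scaleDr T : right_distributive (@alg_scale T) +%R.
Proof. by move=> c x y; rewrite /alg_scale mulrDr. Qed.

Lemma alg_scaleDl T (x : alg_of T) : {morph (@alg_scale T)^~ x : a b / a + b}.
Proof. by move=> a b; rewrite /alg_scale mpolyCD alg_piD mulrDl. Qed.

HB.instance Definition _ (T : 'M[F]_n) :=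
  GRing.Zmodule_isLmodule.Build F (alg_of T)
    (@alg_scaleA T) (@alg_scale1 T) (@alg_scaleDr T) (@alg_scaleDl T).

Lemma alg_scaleAl T c (x y : alg_of T) : c *: (x * y) = (c *: x) * y.
Proof. exact: mulrA. Qed.

HB.instance Definition _ (T : 'M[F]_n) :=
  GRing.Lmodule_isLalgebra.Build F (alg_of T) (@alg_scaleAl T).

Lemma alg_scaleAr T c (x y : alg_of T) : c *: (x * y) = x * (c *: y).
Proof. exact: mulrCA. Qed.

HB.instance Definition _ (T : 'M[F]_n) :=
  GRing.Lalgebra_isAlgebra.Build F (alg_of T) (@alg_scaleAr T).

(* Every generator has degree 2. *)
Definition has_degree (T : 'M[F]_n) (d : nat) (x : alg_of T) : Prop :=
  exists2 p : {mpoly F[n]},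
    (forall m, m \in msupp p -> (2 * mdeg m)%N = d) & alg_pi T p = x.

Definition graded_iso (T S : 'M[F]_n) : Prop :=
  exists f : {lrmorphism alg_of T -> alg_of S},
    bijective f /\
    forall (d : nat) (x : alg_of T), has_degree d x <-> has_degree d (f x).

End Algebra.

Definition matrix_of_rows (F : fieldType) (n : nat) (rows : seq (seq F)) : 'M[F]_n :=
  \matrix_(i, j) nth 0 (nth [::] rows i) j.

Section Representatives.
Variable F : fieldType.

Definition mxB : 'M[F]_4 := matrix_of_rows 4
  [:: [:: 0; 0; 0; 0];
      [:: 0; 0; 0; 0];
      [:: 0; 0; 0; 0];
      [:: 1; 1; 0; 0]].

Definition mxB' : 'M[F]_4 := matrix_of_rows 4
  [:: [:: 0; 0; 0; 0];
      [:: 0; 0; 0; 0];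
      [:: 0; 0; 0; 0];
      [:: 1; 1; 1; 0]].

Definition mxD1 : 'M[F]_4 := matrix_of_rows 4
  [:: [:: 0; 0; 0; 0];
      [:: 0; 0; 0; 0];
      [:: 1; 1; 0; 0];
      [:: 1; 1; 0; 0]].

Definition mxC (z : F) : 'M[F]_4 := matrix_of_rows 4
  [:: [:: 0; 0; 0; 0];
      [:: 0; 0; 0; 0];
      [:: 1; 1; 0; 0];
      [:: z; 0; 1; 0]].

End Representatives.

(* The norm and the order on [R[i]] are those of a [numClosedFieldType]:
   [`|w|] is a real element of [R[i]], and [x < y] forces [x] and [y] to have
   the same imaginary part. *)
Definition in_U (R : realType) (z : R[i]) : Prop :=
  `|z + 2^-1| < 2^-1 \/ (`|z + 2^-1| = 2^-1 /\ 0 <= complex.Im z).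

Definition representative (R : realType) (S : 'M[R[i]]_4) : Prop :=
  [\/ S = 0, S = mxB _, S = mxB' _ | S = mxD1 _] \/
  exists2 z : R[i], in_U z & S = mxC z.

(* Main.v *)
(** Over a field of characteristic not 2, a graded isomorphism [A(T) -> A(S)] is
    a linear change of the generators carrying the span of the quadratic relators
    of [T] onto that of [S].  Completing squares turns the relators into
    [x0^2], [x1^2], [x2^2 - c x0 x1], [x3^2 - (p x0 x1 + q x0 x2 + r x1 x2)],
    and rescaling or permuting the variables reduces [(c; p, q, r)] to
    [(0; 0, 0, 0)], [(0; 1/2, 0, 0)], [(0; 1/2, 1/2, 1/2)], [(1/2; 1/2, 0, 0)] or
    [(1/2; (1+u)/8, u/4, 1/4)]; these are the forms of [0], [B], [B'], [D_1] and
    [C_z] with [u = 2z + 1].  They are told apart by the linear forms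
    whose square is a combination of relators: few forms have this property, so a
    change of variables between two normal forms is nearly monomial.  For the last
    family what remains is [u' = u] or [u u' = 1], and [u -> 1/u] has the half-open
    disk [|u| < 1] or [|u| = 1, Im u >= 0] as a fundamental domain. *)
Require Import Defs.
From HB Require Import structures.
From mathcomp Require Import all_boot all_order all_algebra perm.
From mathcomp Require Import generic_quotient ring_quotient mpoly boolp.
From mathcomp Require Import reals complex ring.

Set Implicit Arguments.
Unset Strict Implicit.
Unset Printing Implicit Defensive.

Import Order.TTheory GRing.Theory Num.Theory.
Local Open Scope ring_scope.

(** * Linear substitutions and quadratic forms *)

(** Evaluation at points turns identities between relators into identities in the field, where
    [ring] and [field] apply. *)
Definition relators_at (F : fieldType) n (T : 'M[F]_n) (v : 'rV[F]_n) : 'rV[F]_n :=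
  \row_i (relator T i).@[v 0].

(* A row vector [v] is a point, so column [j] of [M] holds the coefficients of
   the linear form substituted for the [j]-th variable. *)
Definition equivalent (F : fieldType) n (Q Q' : 'rV[F]_n -> 'rV[F]_n) : Prop :=
  exists M C : 'M[F]_n, [/\ M \in unitmx, C \in unitmx &
    forall v, Q (v *m M) = Q' v *m C].

Definition qform (F : fieldType) n (A : 'M[F]_n) : {mpoly F[n]} :=
  \sum_i \sum_j A i j *: ('X_i * 'X_j).

Lemma qformZD (F : fieldType) n a (A B : 'M[F]_n) :
  qform (a *: A + B) = a *: qform A + qform B.
Proof.
rewrite scaler_sumr -big_split; apply: eq_bigr => i _ /=.
rewrite scaler_sumr -big_split; apply: eq_bigr => j _ /=.
by rewrite !mxE scalerDl scalerA.
Qed.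

HB.instance Definition _ (F : fieldType) n :=
  GRing.isLinear.Build F 'M[F]_n {mpoly F[n]} _ (@qform F n) (@qformZD F n).

Lemma qform_delta (F : fieldType) n (i j : 'I_n) :
  qform (delta_mx i j : 'M[F]_n) = 'X_i * 'X_j.
Proof.
rewrite /qform (bigD1 i) //= [X in _ + X]big1 => [|k /negPf ki].
  rewrite (bigD1 j) //= big1 => [|k /negPf kj].
    by rewrite mxE !eqxx scale1r !addr0.
  by rewrite mxE kj andbF scale0r.
by rewrite big1 // => l _; rewrite mxE ki scale0r.
Qed.

Lemma qform_trmx (F : fieldType) n (A : 'M[F]_n) : qform A^T = qform A.
Proof.
rewrite /qform exchange_big; apply: eq_bigr => i _; apply: eq_bigr => j _ /=.
by rewrite mxE mulrC.
Qed.

Lemma meval_qform (F : fieldType) n (A : 'M[F]_n) (v : 'rV[F]_n) :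
  (qform A).@[v 0] = (v *m A *m v^T) 0 0.
Proof.
rewrite /qform raddf_sum mxE /=; under eq_bigr do rewrite raddf_sum.
rewrite exchange_big; apply: eq_bigr => j _ /=.
rewrite mxE big_distrl; apply: eq_bigr => i _ /=.
by rewrite mevalZ mevalM !mevalXU !mxE mulrA [A i j * _]mulrC.
Qed.

(** Values at basis vectors kill the diagonal of [A], and values at their sums make [A]
    antisymmetric. As the variables commute, [qform A = - qform A], and 2 is invertible. *)
Lemma qform_eq0 (F : fieldType) n (A : 'M[F]_n) :
  2 != 0 :> F -> (forall v : 'rV_n, (qform A).@[v 0] = 0) -> qform A = 0.
Proof.
move=> nz2 A0.
have entry (v w : 'I_n) : (('e_v : 'rV[F]_n) *m A *m ('e_w : 'rV[F]_n)^T) 0 0 = A v w.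
  by rewrite -rowE trmx_delta -colE !mxE.
have Aii i : A i i = 0 by rewrite -(A0 'e_i) meval_qform entry.
have AT : A^T = - A.
  apply/matrixP => i j; rewrite !mxE; apply/eqP; rewrite -addr_eq0; apply/eqP.
  have := A0 ('e_i + 'e_j); rewrite meval_qform.
  rewrite linearD /= mulmxDr !mulmxDl mxE ![((_ + _) : 'M_(_,_)) 0 0]mxE !entry.
  by rewrite !Aii add0r addr0.
have := qform_trmx A; rewrite AT raddfN /= => /eqP.
rewrite eq_sym -addr_eq0 -mulr2n -scaler_nat scaler_eq0 (negPf nz2) /=.
by move/eqP.
Qed.

Definition relator_mx (F : fieldType) n (T : 'M[F]_n) (i : 'I_n) : 'M[F]_n :=
  delta_mx i i - \sum_(j < n | (j < i)%N) T i j *: delta_mx j i.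

Lemma relatorE (F : fieldType) n (T : 'M[F]_n) i :
  relator T i = qform (relator_mx T i).
Proof.
rewrite /relator raddfB /= qform_delta -expr2; congr (_ - _).
by rewrite raddf_sum; apply: eq_bigr => j _ /=; rewrite linearZ /= qform_delta.
Qed.

Definition linear_subst (F : fieldType) n (M : 'M[F]_n) : n.-tuple {mpoly F[n]} :=
  [tuple \sum_j M j i *: 'X_j | i < n].

Lemma meval_subst (F : fieldType) n (M : 'M[F]_n) (p : {mpoly F[n]}) (v : 'rV[F]_n) :
  (p \mPo linear_subst M).@[v 0] = p.@[(v *m M) 0].
Proof.
rewrite comp_mpoly_meval; apply: meval_eq => i.
rewrite tnth_mktuple raddf_sum mxE; apply: eq_bigr => j _ /=.
by rewrite mevalZ mevalXU mulrC.
Qed.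

Lemma linear_subst_Xi (F : fieldType) n (M : 'M[F]_n) i :
  'X_i \mPo linear_subst M = \sum_j M j i *: 'X_j.
Proof. by rewrite comp_mpolyXU -tnth_nth tnth_mktuple. Qed.

Lemma linear_subst_qform (F : fieldType) n (M A : 'M[F]_n) :
  qform A \mPo linear_subst M = qform (M *m A *m M^T).
Proof.
(* With [X] the row of variables, a form is [X B X^T] over the polynomial ring, and the substitution
   multiplies [X] by [M]. *)
pose X : 'rV[{mpoly F[n]}]_n := \row_i 'X_i.
have qE B : qform B = (X *m map_mx (@mpolyC n F) B *m X^T) 0 0.
  rewrite /qform !mxE exchange_big; apply: eq_bigr => j _ /=.
  rewrite mxE big_distrl; apply: eq_bigr => i _ /=.
  by rewrite !mxE -mul_mpolyC mulrA [_%:MP * _]mulrC.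
have XM : map_mx (comp_mpoly (linear_subst M)) X = X *m map_mx (@mpolyC n F) M.
  apply/rowP => i; rewrite !mxE linear_subst_Xi; apply: eq_bigr => j _.
  by rewrite !mxE mulrC mul_mpolyC.
transitivity ((map_mx (comp_mpoly (linear_subst M))
                 (X *m map_mx (@mpolyC n F) A *m X^T)) 0 0).
  by rewrite [RHS]mxE qE.
rewrite !map_mxM -map_trmx XM.
have -> : map_mx (comp_mpoly (linear_subst M)) (map_mx (@mpolyC n F) A) =
          map_mx (@mpolyC n F) A.
  by apply/matrixP => i j; rewrite !mxE comp_mpolyC.
by rewrite qE !map_mxM -!map_trmx trmx_mul !mulmxA.
Qed.

(** The difference of the two sides is a quadratic form vanishing at every point, so [qform_eq0]
    lifts the pointwise identity to polynomials. *)
Lemma linear_subst_relator (F : fieldType) n (T S M C : 'M[F]_n) :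
  2 != 0 :> F ->
  (forall v, relators_at T (v *m M) = relators_at S v *m C) ->
  forall i, relator T i \mPo linear_subst M = \sum_k C k i *: relator S k.
Proof.
move=> nz2 TS i.
pose A := M *m relator_mx T i *m M^T - \sum_k C k i *: relator_mx S k.
have qA : relator T i \mPo linear_subst M - \sum_k C k i *: relator S k = qform A.
  rewrite [RHS]raddfB /= -linear_subst_qform -relatorE; congr (_ - _).
  by rewrite raddf_sum; apply: eq_bigr => k _ /=; rewrite linearZ /= -relatorE.
apply/eqP; rewrite -subr_eq0 qA; apply/eqP/qform_eq0 => // v.
rewrite -qA mevalB meval_subst; apply/eqP; rewrite subr_eq0; apply/eqP.
have /rowP/(_ i) := TS v; rewrite !mxE raddf_sum => ->; apply: eq_bigr => k _ /=.
by rewrite !mxE mevalZ mulrC.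
Qed.

Lemma linear_subst_comp (F : fieldType) n (M N : 'M[F]_n) p :
  p \mPo linear_subst M \mPo linear_subst N = p \mPo linear_subst (N *m M).
Proof.
rewrite [p \mPo linear_subst M]comp_mpolyEX [in RHS]comp_mpolyEX raddf_sum.
apply: eq_bigr => m _ /=.
rewrite comp_mpolyZ; congr (_ *: _); rewrite !comp_mpolyX rmorph_prod.
apply: eq_bigr => i _ /=; rewrite rmorphXn /= !tnth_mktuple; congr (_ ^+ _).
rewrite raddf_sum /=; under eq_bigr do rewrite comp_mpolyZ linear_subst_Xi scaler_sumr.
rewrite exchange_big; apply: eq_bigr => j _ /=.
by rewrite mxE scaler_suml; apply: eq_bigr => k _; rewrite scalerA mulrC.
Qed.

Lemma linear_subst1 (F : fieldType) n (p : {mpoly F[n]}) :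
  p \mPo linear_subst 1%:M = p.
Proof.
rewrite -[RHS]comp_mpoly_id; congr (_ \mPo _); apply/eq_from_tnth => i.
rewrite !tnth_mktuple (bigD1 i) //= big1 => [|j /negPf ji].
  by rewrite mxE eqxx scale1r addr0.
by rewrite mxE ji scale0r.
Qed.

Lemma linear_subst_homog (F : fieldType) n (M : 'M[F]_n) d (p : {mpoly F[n]}) :
  p \is d.-homog -> p \mPo linear_subst M \is d.-homog.
Proof.
move=> /dhomogP hp; rewrite comp_mpolyEX big_seq; apply: rpred_sum => m mp.
apply: rpredZ; have <- : mdeg m = d := hp m mp; rewrite comp_mpolyX mdegE.
elim/big_ind2: _ => [|d1 p1 d2 p2 h1 h2|i _].
- exact: dhomog1.
- exact: dhomogM.
- have hi : tnth (linear_subst M) i \is 1.-homog.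
    rewrite tnth_mktuple; apply: rpred_sum => j _; apply: rpredZ.
    by rewrite dhomogX /= mdeg1.
  by have := dhomogMn (m i) hi; rewrite mul1n.
Qed.

(** * Graded isomorphisms as equivalences of quadratic maps *)

Lemma alg_pi_eqP (F : fieldType) n (T : 'M[F]_n) (p q : {mpoly F[n]}) :
  alg_pi T p = alg_pi T q <-> in_rel_ideal T (p - q).
Proof.
have := Quotient.idealrBE (rel_ideal T) p q => E.
split=> [pq|pq].
  by apply/asboolP; move: E; rewrite unfold_in => ->; apply/eqP.
by apply/eqP; rewrite -[_ == _]E unfold_in; apply/asboolP.
Qed.

Lemma alg_piZ (F : fieldType) n (T : 'M[F]_n) c (p : {mpoly F[n]}) :
  alg_pi T (c *: p) = c *: alg_pi T p.
Proof. by rewrite -mul_mpolyC alg_piM. Qed.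

Lemma alg_pi_linear (F : fieldType) n (T : 'M[F]_n) : linear (alg_pi T).
Proof. by move=> c p q; rewrite alg_piD alg_piZ. Qed.

HB.instance Definition _ (F : fieldType) n (T : 'M[F]_n) :=
  GRing.isLinear.Build F {mpoly F[n]} (alg_of T) _ (alg_pi T) (@alg_pi_linear F n T).

HB.instance Definition _ (F : fieldType) n (T : 'M[F]_n) :=
  GRing.isMonoidMorphism.Build {mpoly F[n]} (alg_of T) (alg_pi T)
    (conj (alg_pi1 T) (alg_piM T)).

Lemma alg_piK (F : fieldType) n (T : 'M[F]_n) (x : alg_of T) :
  alg_pi T (repr x) = x.
Proof. exact: reprK. Qed.

Lemma linear_subst_ideal (F : fieldType) n (T S M C : 'M[F]_n) p :
  (forall i, relator T i \mPo linear_subst M = \sum_k C k i *: relator S k) ->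
  in_rel_ideal T p -> in_rel_ideal S (p \mPo linear_subst M).
Proof.
move=> TS [h ->]; exists (fun k => \sum_i C k i *: (h i \mPo linear_subst M)).
rewrite raddf_sum; under [RHS]eq_bigr do rewrite mulr_suml.
rewrite exchange_big; apply: eq_bigr => i _ /=.
rewrite rmorphM /= TS mulr_sumr; apply: eq_bigr => k _.
by rewrite -scalerAl scalerAr.
Qed.

(** Each substitution carries one ideal into the other, so the two induce mutually inverse maps of
    the quotients. Degrees are kept because linear forms replace variables. *)
Lemma graded_iso_of_subst (F : fieldType) n (T S M N C D : 'M[F]_n) :
  M *m N = 1%:M -> N *m M = 1%:M ->
  (forall i, relator T i \mPo linear_subst M = \sum_k C k i *: relator S k) ->
  (forall i, relator S i \mPo linear_subst N = \sum_k D k i *: relator T k) ->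
  graded_iso T S.
Proof.
move=> MN NM TS ST.
pose f (x : alg_of T) : alg_of S := alg_pi S (repr x \mPo linear_subst M).
pose g (x : alg_of S) : alg_of T := alg_pi T (repr x \mPo linear_subst N).
have fE p : f (alg_pi T p) = alg_pi S (p \mPo linear_subst M).
  apply/alg_pi_eqP; rewrite -raddfB; apply: (linear_subst_ideal TS).
  by apply/alg_pi_eqP; rewrite alg_piK.
have gE p : g (alg_pi S p) = alg_pi T (p \mPo linear_subst N).
  apply/alg_pi_eqP; rewrite -raddfB; apply: (linear_subst_ideal ST).
  by apply/alg_pi_eqP; rewrite alg_piK.
have fD : linear f.
  move=> c x y; rewrite -[x]alg_piK -[y]alg_piK -linearP !fE.
  by rewrite linearP /= linearP.
have fM : monoid_morphism f.
  split=> [|x y]; first by rewrite -(alg_pi1 T) fE rmorph1 alg_pi1.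
  by rewrite -[x]alg_piK -[y]alg_piK -rmorphM !fE rmorphM /= rmorphM.
pose flin := GRing.isLinear.Build F (alg_of T) (alg_of S) _ f fD.
pose fmul := GRing.isMonoidMorphism.Build (alg_of T) (alg_of S) f fM.
pose F' : {lrmorphism alg_of T -> alg_of S} := HB.pack f flin fmul.
have fK : cancel f g.
  move=> x; rewrite -[x]alg_piK fE gE linear_subst_comp NM.
  by rewrite linear_subst1.
have gK : cancel g f.
  by move=> x; rewrite -[x]alg_piK gE fE linear_subst_comp MN linear_subst1.
(* The zero polynomial is treated apart: its support has no monomial from which to read off the
   degree. *)
have even_homog m (p : {mpoly F[n]}) d :
    (forall k, k \in msupp p -> (2 * mdeg k)%N = d) ->
    forall k, k \in msupp (p \mPo linear_subst m) -> (2 * mdeg k)%N = d.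
  move=> pd; have [-> k|] := eqVneq p 0; first by rewrite raddf0 msupp0.
  rewrite -msupp_eq0; case E : (msupp p) => [//|k0 s] _ k.
  have hp : p \is (mdeg k0).-homog.
    apply/dhomogP => l /pd /=; rewrite -(pd k0) ?E ?mem_head // => /eqP.
    by rewrite eqn_pmul2l // => /eqP.
  move/(dhomogP _ _ _): (linear_subst_homog m hp) => h /h /= ->.
  by rewrite pd // E mem_head.
exists F'; split; first by exists g.
move=> d x; split=> -[p pd px].
  exists (p \mPo linear_subst M); first exact: even_homog pd.
  by rewrite -fE px.
exists (p \mPo linear_subst N); first exact: even_homog pd.
by rewrite -gE px fK.
Qed.

(** The nonconstant monomials of [h] push [r] into degrees above [d], so only the constant term of
    [h] contributes. *)
Lemma mcoeff_mul_homog (F : fieldType) n (h r : {mpoly F[n]}) d m :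
  r \is d.-homog -> (mdeg m <= d)%N -> (h * r)@_m = h@_0 * r@_m.
Proof.
move=> hr md; have [k [hk k0]] : exists k, k@_0 = 0 /\ h = (h@_0)%:MP + k.
  by exists (h - (h@_0)%:MP); rewrite mcoeffB mcoeffC eqxx mulr1 subrr addrC subrK.
rewrite {1}k0 mulrDl mcoeffD mcoeffCM [X in _ + X](_ : _ = 0) ?addr0 //.
rewrite [k]mpolyE mulr_suml raddf_sum big_seq big1 //= => l kl.
have hl : 'X_[l] * r \is (mdeg l + d).-homog by apply: dhomogM; rewrite ?dhomogX.
rewrite -scalerAl mcoeffZ (dhomog_nemf_coeff hl) ?mulr0 //.
apply/eqP => /= E; move: md; rewrite E -{2}[d]add0n leq_add2r leqn0 mdeg_eq0.
by apply/negP; apply: contraTneq kl => ->; rewrite mcoeff_msupp hk eqxx.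
Qed.

Lemma relator_homog (F : fieldType) n (T : 'M[F]_n) i : relator T i \is 2.-homog.
Proof.
have XX j k : 'X_j * 'X_k \is [in F[n], 2.-homog].
  by rewrite -mpolyXD dhomogX /= mdegD !mdeg1.
by rewrite rpredB ?expr2 // rpred_sum // => j _; rewrite rpredZ.
Qed.

(** In degree two only the constant terms of the multipliers survive, so this part of the ideal is
    the span of the relators. *)
Lemma rel_ideal_homog2 (F : fieldType) n (T : 'M[F]_n) p :
  in_rel_ideal T p -> p \is 2.-homog ->
  exists c : 'I_n -> F, p = \sum_k c k *: relator T k.
Proof.
move=> [h ph] hp; exists (fun k => (h k)@_0); apply/mpolyP => m.
have [md|md] := eqVneq (mdeg m) 2.
  rewrite ph !raddf_sum; apply: eq_bigr => k _ /=.
  by rewrite mcoeffZ (mcoeff_mul_homog _ (relator_homog T k)) ?md.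
have hr : \sum_k (h k)@_0 *: relator T k \is 2.-homog.
  by apply: rpred_sum => k _; rewrite rpredZ ?relator_homog.
by rewrite (dhomog_nemf_coeff hp) // (dhomog_nemf_coeff hr).
Qed.

(** The ideal has no part of degree one, so the generators stay linearly independent in the
    algebra. *)
Lemma rel_ideal_linear (F : fieldType) n (T : 'M[F]_n) (a : 'I_n -> F) :
  in_rel_ideal T (\sum_j a j *: 'X_j) -> a =1 fun=> 0.
Proof.
move=> [h /(congr1 (fun p => mcoeff _ p)) ph] i.
have := ph U_(i)%MM; rewrite !raddf_sum (bigD1 i) //= big1 => [|j ji].
  rewrite mcoeffZ mcoeffXU eqxx mulr1 addr0 => ->; rewrite big1 // => k _.
  rewrite (mcoeff_mul_homog _ (relator_homog T k)) ?mdeg1 //.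
  by rewrite (dhomog_nemf_coeff (relator_homog T k)) ?mulr0 //= mdeg1.
by rewrite mcoeffZ mcoeffXU (negPf ji) mulr0.
Qed.

Lemma homog1E (F : fieldType) n (p : {mpoly F[n]}) :
  p \is 1.-homog -> p = \sum_j p@_U_(j) *: 'X_j.
Proof.
move=> hp; apply/mpolyP => m; rewrite raddf_sum /=.
have [/mdeg1P[i /eqP->]|md] := boolP (mdeg m == 1%N).
  rewrite (bigD1 i) //= big1 => [|j ji].
    by rewrite mcoeffZ mcoeffXU eqxx mulr1 addr0.
  by rewrite mcoeffZ mcoeffXU (negPf ji) mulr0.
rewrite (dhomog_nemf_coeff hp) // big1 // => j _.
rewrite mcoeffZ mcoeffX; case: eqP => [jm|]; last by rewrite mulr0.
by rewrite -jm mdeg1 in md.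
Qed.

Lemma equivalent_refl (F : fieldType) n (Q : 'rV[F]_n -> 'rV[F]_n) : equivalent Q Q.
Proof. by exists 1%:M, 1%:M; split=> [||v]; rewrite ?unitmx1 // !mulmx1. Qed.

Lemma equivalent_sym (F : fieldType) n (Q Q' : 'rV[F]_n -> 'rV[F]_n) :
  equivalent Q Q' -> equivalent Q' Q.
Proof.
move=> [M [C [uM uC QQ']]]; exists (invmx M), (invmx C).
by split=> [||v]; rewrite ?unitmx_inv // -[in RHS](mulmxKV uM v) QQ' mulmxK.
Qed.

Lemma equivalent_trans (F : fieldType) n (Q1 Q2 Q3 : 'rV[F]_n -> 'rV[F]_n) :
  equivalent Q1 Q2 -> equivalent Q2 Q3 -> equivalent Q1 Q3.
Proof.
move=> [M [C [uM uC Q12]]] [N [D [uN uD Q23]]]; exists (N *m M), (D *m C).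
by split=> [||v]; rewrite ?unitmx_mul ?uM ?uN ?uC ?uD // !mulmxA Q12 Q23.
Qed.

Lemma relators_at_delta (F : fieldType) n (T : 'M[F]_n) j :
  relators_at T 'e_j = 'e_j.
Proof.
apply/rowP => i; rewrite !mxE /relator mevalB rmorphXn /= mevalXU !mxE /=.
rewrite [X in _ - X](_ : _ = 0) ?subr0; first by case: (i == j); rewrite ?expr1n ?expr0n.
rewrite raddf_sum big1 //= => k ki; rewrite mevalZ mevalM !mevalXU !mxE /=.
have [<-|] := eqVneq k j; last by rewrite mul0r mulr0.
by rewrite -(inj_eq val_inj) gtn_eqF ?mulr0.
Qed.

(** An isomorphism is read off in two places: its action on the generators gives [M], and its action
    on the quadratic relators gives [C]. *)
Lemma graded_iso_equivalent (F : fieldType) n (T S : 'M[F]_n) :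
  2 != 0 :> F -> graded_iso T S <-> equivalent (relators_at T) (relators_at S).
Proof.
move=> nz2; split=> [[f [[g fK gK] fdeg]]|TS].
  have deg2X U i : has_degree (T := U) 2 (alg_pi U 'X_i).
    by exists 'X_i => // m; rewrite msuppX inE => /eqP ->; rewrite mdeg1.
  have deg2E U x : has_degree (T := U) 2 x ->
      exists a : 'I_n -> F, x = alg_pi U (\sum_j a j *: 'X_j).
    move=> [p pd <-]; exists (fun j => p@_U_(j)); rewrite -homog1E //.
    apply/dhomogP => m /pd /= /eqP.
    by rewrite -[2%N in X in _ == X]muln1 eqn_pmul2l // => /eqP.
  have /choice[a fa] i : exists a : 'I_n -> F,
      f (alg_pi T 'X_i) = alg_pi S (\sum_j a j *: 'X_j).
    by apply: deg2E; apply/fdeg.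
  have /choice[b gb] i : exists b : 'I_n -> F,
      g (alg_pi S 'X_i) = alg_pi T (\sum_j b j *: 'X_j).
    by apply: deg2E; apply/fdeg; rewrite gK.
  pose M := \matrix_(j, i) a i j; pose N := \matrix_(k, j) b j k.
  have fM p : f (alg_pi T p) = alg_pi S (p \mPo linear_subst M).
    rewrite comp_mpolyEX {1}[p]mpolyE !raddf_sum; apply: eq_bigr => m _ /=.
    rewrite !linearZ /= mpolyXE_id !rmorph_prod; congr (_ *: _).
    apply: eq_bigr => i _; rewrite !rmorphXn /= fa linear_subst_Xi.
    by congr (alg_pi _ _ ^+ _); apply: eq_bigr => j _; rewrite mxE.
  (* Linear forms that agree modulo the ideal of [S] have the same coefficients, so
     [f (g X_j) = X_j] becomes an identity of matrices. *)
  have MN : M *m N = 1%:M.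
    apply/matrixP => l j; apply/eqP; rewrite -subr_eq0; apply/eqP.
    apply: (@rel_ideal_linear _ _ S (fun l => (M *m N) l j - 1%:M l j)).
    have -> : \sum_l ((M *m N) l j - (1%:M : 'M_n) l j) *: 'X_l =
              ('X_j \mPo linear_subst N \mPo linear_subst M) -
              ('X_j \mPo linear_subst 1%:M).
      rewrite linear_subst_comp !linear_subst_Xi -sumrB.
      by apply: eq_bigr => k _; rewrite scalerBl.
    apply/alg_pi_eqP; rewrite -fM linear_subst1 linear_subst_Xi.
    by under eq_bigr do rewrite mxE; rewrite -gb gK.
  have uM : M \in unitmx by case/mulmx1_unit: MN.
  have /choice[c cE] i : exists c : 'I_n -> F,
      relator T i \mPo linear_subst M = \sum_k c k *: relator S k.
    apply: rel_ideal_homog2; last exact/linear_subst_homog/relator_homog.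
    rewrite -[_ \mPo _]subr0; apply/alg_pi_eqP; rewrite -fM raddf0 -(raddf0 f).
    congr (f _); rewrite -(raddf0 (alg_pi T)); apply/alg_pi_eqP; rewrite subr0.
    exists (fun k => (k == i)%:R); rewrite (bigD1 i) //= eqxx mul1r big1 ?addr0 //.
    by move=> k /negPf ->; rewrite mul0r.
  pose C := \matrix_(k, i) c i k.
  have TS v : relators_at T (v *m M) = relators_at S v *m C.
    apply/rowP => i; rewrite !mxE -meval_subst cE raddf_sum.
    by apply: eq_bigr => k _ /=; rewrite !mxE mevalZ mulrC.
  exists M, C; split=> //.
  (* At the point ['e_j *m invmx M] the identity [TS] has left side [relators_at T 'e_j = 'e_j]; the
     values of [relators_at S] there are thus the rows of a left inverse of [C]. *)
  have /mulmx1_unit[_ //] : \matrix_j relators_at S ('e_j *m invmx M) *m C = 1%:M.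
  apply/row_matrixP => j.
  by rewrite row_mul rowK -TS mulmxKV // relators_at_delta rowE mulmx1.
have [M [C [uM uC MC]]] := TS.
apply: (graded_iso_of_subst (mulmxV uM) (mulVmx uM) (linear_subst_relator nz2 MC)).
apply: (linear_subst_relator (C := invmx C) nz2) => v.
by rewrite -[in RHS](mulmxKV uM v) MC mulmxK.
Qed.

(** * Normal forms *)

Local Notation o0 := (@Ordinal 4 0 isT).
Local Notation o1 := (@Ordinal 4 1 isT).
Local Notation o2 := (@Ordinal 4 2 isT).
Local Notation o3 := (@Ordinal 4 3 isT).

Lemma sum4 (V : nmodType) (f : 'I_4 -> V) : \sum_i f i = f o0 + f o1 + f o2 + f o3.
Proof.
rewrite !big_ord_recl big_ord0 addr0 !addrA.
by congr (f _ + f _ + f _ + f _); apply: val_inj.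
Qed.

Lemma forall4 (P : 'I_4 -> Prop) : P o0 -> P o1 -> P o2 -> P o3 -> forall i, P i.
Proof.
by move=> P0 P1 P2 P3 [[|[|[|[|k]]]] lti] //; rewrite (bool_irrelevance lti isT).
Qed.

Lemma rows_trig_unit (F : fieldType) (s : seq (seq F)) :
  let A := matrix_of_rows 4 s in
  (forall i j : 'I_4, (i < j)%N -> A i j = 0) -> (forall i, A i i != 0) -> A \in unitmx.
Proof.
move=> A A0 Ad; rewrite unitmxE det_trig; last first.
  by apply/forallP => i; apply/forallP => j; apply/implyP => ij; apply/eqP/A0.
by rewrite unitfE; apply/prodf_neq0.
Qed.

Definition normal_form (F : fieldType) (c p q r : F) (v : 'rV[F]_4) : 'rV[F]_4 :=
  \row_i nth 0 [:: v 0 o0 ^+ 2; v 0 o1 ^+ 2; v 0 o2 ^+ 2 - c * (v 0 o0 * v 0 o1);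
    v 0 o3 ^+ 2 - (p * (v 0 o0 * v 0 o1) + q * (v 0 o0 * v 0 o2)
                   + r * (v 0 o1 * v 0 o2))] i.

Lemma relators_atE (F : fieldType) n (T : 'M[F]_n) v i :
  relators_at T v 0 i =
  v 0 i ^+ 2 - \sum_(j < n) (if (j < i)%N then T i j * (v 0 j * v 0 i) else 0).
Proof.
rewrite -big_mkcond !mxE /relator mevalB rmorphXn /= mevalXU; congr (_ - _).
by rewrite raddf_sum; apply: eq_bigr => j _ /=; rewrite mevalZ mevalM !mevalXU.
Qed.

(* The new variables are [y_i = x_i - L_i / 2], where [x_i ^+ 2 - L_i x_i] is the
   [i]-th relator; [a], [b] and [f], [g], [h] are the coefficients of [L_2] and
   [L_3] in the new variables. *)
Lemma normal_form_relators (F : numFieldType) (T : 'M[F]_4) :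
  let h := T o3 o2 in
  let a := T o2 o0 + T o2 o1 * T o1 o0 / 2 in let b := T o2 o1 in
  let f := T o3 o0 + T o3 o1 * T o1 o0 / 2 + h * a / 2 in
  let g := T o3 o1 + h * b / 2 in
  equivalent (relators_at T)
    (normal_form (a * b / 2) (f * g / 2 + h ^+ 2 * (a * b / 2) / 4)
       (f * h / 2) (g * h / 2)).
Proof.
move=> h a b f g.
pose M := matrix_of_rows 4 [:: [:: 1; 0; 0; 0]; [:: T o1 o0 / 2; 1; 0; 0];
  [:: a / 2; b / 2; 1; 0]; [:: f / 2; g / 2; h / 2; 1]].
pose C := matrix_of_rows 4 [:: [:: 1; 0; 0; 0]; [:: - (T o1 o0 ^+ 2 / 4); 1; 0; 0];
  [:: - (a ^+ 2 / 4); - (b ^+ 2 / 4); 1; 0];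
  [:: - (f ^+ 2 / 4); - (g ^+ 2 / 4); - (h ^+ 2 / 4); 1]].
exists M^T, C^T; split=> [||v].
- rewrite unitmx_tr; apply: rows_trig_unit; do ![apply: forall4 => //=];
    by rewrite ?mxE ?oner_eq0.
- rewrite unitmx_tr; apply: rows_trig_unit; do ![apply: forall4 => //=];
    by rewrite ?mxE ?oner_eq0.
by apply/rowP; apply: forall4; rewrite relators_atE sum4 ![(_ *m _) _ _]mxE !sum4
  !mxE /= /f /g /a /b /h; field.
Qed.

(** Scaling the variables by [al], [be], [ga], [de] multiplies each relator by the square of its own
    factor; the four equations say that the mixed terms follow. *)
Lemma normal_form_scale (F : fieldType) (c p q r c' p' q' r' al be ga de : F) :
  al != 0 -> be != 0 -> ga != 0 -> de != 0 ->
  c * (al * be) = c' * ga ^+ 2 -> p * (al * be) = p' * de ^+ 2 ->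
  q * (al * ga) = q' * de ^+ 2 -> r * (be * ga) = r' * de ^+ 2 ->
  equivalent (normal_form c p q r) (normal_form c' p' q' r').
Proof.
move=> al0 be0 ga0 de0 hc hp hq hr.
pose D x y z w : 'M[F]_4 := matrix_of_rows 4 [:: [:: x; 0; 0; 0]; [:: 0; y; 0; 0];
  [:: 0; 0; z; 0]; [:: 0; 0; 0; w]].
have unitD x y z w : x != 0 -> y != 0 -> z != 0 -> w != 0 -> D x y z w \in unitmx.
  move=> ????; apply: rows_trig_unit; do ![apply: forall4 => //=]; by rewrite ?mxE.
exists (D al be ga de), (D (al ^+ 2) (be ^+ 2) (ga ^+ 2) (de ^+ 2)).
split; rewrite ?unitD ?expf_neq0 // => v.
apply/rowP; apply: forall4; rewrite ![_ 0 _]mxE ?sum4 ![(_ *m _) _ _]mxE !sum4 !mxE /=.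
- ring.
- ring.
- rewrite !(mulr0, addr0, add0r) mulrBl.
  have -> : c' * (v 0 o0 * v 0 o1) * ga ^+ 2 = c' * ga ^+ 2 * (v 0 o0 * v 0 o1) by ring.
  by rewrite -hc; ring.
- rewrite !(mulr0, addr0, add0r) mulrBl.
  have -> : (p' * (v 0 o0 * v 0 o1) + q' * (v 0 o0 * v 0 o2)
             + r' * (v 0 o1 * v 0 o2)) * de ^+ 2 =
     p' * de ^+ 2 * (v 0 o0 * v 0 o1) + q' * de ^+ 2 * (v 0 o0 * v 0 o2) +
     r' * de ^+ 2 * (v 0 o1 * v 0 o2) by ring.
  by rewrite -hp -hq -hr; ring.
Qed.

Lemma normal_form_perm (F : fieldType) (s : {perm 'I_4}) (c p q r c' p' q' r' : F) :
  (forall (v : 'rV[F]_4) (i : 'I_4),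
     normal_form c p q r (\row_j v 0 (s j)) 0 i = normal_form c' p' q' r' v 0 (s i)) ->
  equivalent (normal_form c p q r) (normal_form c' p' q' r').
Proof.
move=> H; exists (perm_mx s^-1%g), (perm_mx s^-1%g).
have E (v : 'rV[F]_4) : v *m perm_mx s^-1%g = \row_j v 0 (s j).
  by rewrite -col_permE; apply/rowP => j; rewrite !mxE.
by split; rewrite ?unitmx_perm // => v; apply/rowP => i; rewrite !E H mxE.
Qed.

Lemma normal_form_swap01 (F : fieldType) (c p q r : F) :
  equivalent (normal_form c p q r) (normal_form c p r q).
Proof.
by apply: (normal_form_perm (s := tperm o0 o1)) => v; apply: forall4;
  rewrite !mxE !permE /=; ring.
Qed.

(** With first coefficient 0 the first three relators are plain squares, so [x1] and [x2] become
    interchangeable. *)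
Lemma normal_form_swap12 (F : fieldType) (p q r : F) :
  equivalent (normal_form 0 p q r) (normal_form 0 q p r).
Proof.
by apply: (normal_form_perm (s := tperm o1 o2)) => v; apply: forall4;
  rewrite !mxE !permE /=; ring.
Qed.

(** The last two relators have the same shape here, each involving only [x0 x1] besides its
    square. *)
Lemma normal_form_swap23 (F : fieldType) (c p : F) :
  equivalent (normal_form c p 0 0) (normal_form p c 0 0).
Proof.
by apply: (normal_form_perm (s := tperm o2 o3)) => v; apply: forall4;
  rewrite !mxE !permE /=; ring.
Qed.

Definition normal_form_C (F : fieldType) (u : F) : 'rV[F]_4 -> 'rV[F]_4 :=
  normal_form (1 / 2) ((1 + u) / 8) (u / 4) (1 / 4).

Lemma normal_form_plane (F : numClosedFieldType) (c p : F) :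
  [\/ equivalent (normal_form c p 0 0) (normal_form 0 0 0 0),
      equivalent (normal_form c p 0 0) (normal_form 0 (1 / 2) 0 0) |
      equivalent (normal_form c p 0 0) (normal_form (1 / 2) (1 / 2) 0 0)].
Proof.
(* Rescaling [x2] or [x3] alone by a square root brings a nonzero coefficient to 1/2. *)
have half x : x != 0 -> exists2 y : F, y != 0 & x = 1 / 2 * y ^+ 2.
  move=> x0; exists (sqrtC (2 * x)); last by rewrite sqrtCK; field.
  by rewrite sqrtC_eq0 mulf_neq0 ?pnatr_eq0.
have [->|c0] := eqVneq c 0; have [->|p0] := eqVneq p 0.
- by apply: Or31; apply: (normal_form_scale (al := 1) (be := 1) (ga := 1) (de := 1));
    rewrite ?oner_neq0 //; ring.
- have [y y0 py] := half p p0.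
  by apply: Or32; apply: (normal_form_scale (al := 1) (be := 1) (ga := 1) (de := y));
    rewrite ?oner_neq0 ?py //; ring.
- have [y y0 cy] := half c c0.
  apply: Or32; apply: (equivalent_trans (normal_form_swap23 _ _)).
  by apply: (normal_form_scale (al := 1) (be := 1) (ga := 1) (de := y));
    rewrite ?oner_neq0 ?cy //; ring.
have [y y0 cy] := half c c0; have [z z0 pz] := half p p0.
by apply: Or33; apply: (normal_form_scale (al := 1) (be := 1) (ga := y) (de := z));
    rewrite ?oner_neq0 ?cy ?pz //; ring.
Qed.

(** Put [ga = 1] and [de = h]. The coefficient [r] then fixes [be], the coefficient [c] fixes [al],
    and [q] yields the parameter. The remaining equation holds because the second coefficient is a
    function of [c], [q], [r], [h]. *)
Lemma normal_form_C_of_rneq0 (F : numFieldType) (c q r h : F) :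
  c != 0 -> r != 0 -> h != 0 ->
  equivalent (normal_form c (2 * q * r / h ^+ 2 + h ^+ 2 * c / 4) q r)
    (normal_form_C (8 * q * r / (h ^+ 4 * c))).
Proof.
move=> c0 r0 h0.
apply: (normal_form_scale (al := 2 * r / (c * h ^+ 2)) (be := h ^+ 2 / (4 * r))
  (ga := 1) (de := h)).
- by rewrite !mulf_neq0 ?invr_eq0 ?mulf_neq0 ?expf_neq0 ?pnatr_eq0.
- by rewrite !mulf_neq0 ?invr_eq0 ?mulf_neq0 ?expf_neq0 ?pnatr_eq0.
- exact: oner_neq0.
- exact: h0.
all: by field; rewrite ?c0 ?r0 ?h0 ?pnatr_eq0.
Qed.

(** Swapping [x0] and [x1] exchanges [u/4] and [1/4]; scaling [x3] by a square root of [u] divides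
    the mixed part of the last relator by [u] and restores the shape. *)
Lemma normal_form_C_inv (F : numClosedFieldType) (u : F) :
  u != 0 -> equivalent (normal_form_C u) (normal_form_C u^-1).
Proof.
move=> u0; apply: (equivalent_trans (normal_form_swap01 _ _ _ _)).
by apply: (normal_form_scale (al := 1) (be := 1) (ga := 1) (de := sqrtC u));
  rewrite ?oner_neq0 ?sqrtC_eq0 // ?sqrtCK; field.
Qed.

(** If [h = 0] or [f = g = 0], only [x0 x1] occurs. If [a b = 0] and just one of [f], [g] vanishes,
    a single mixed monomial is left and is moved to [x0 x1]; if neither does, all three are scaled
    to 1/2. Otherwise the parametrized family appears, after swapping [x0] and [x1] when [g = 0]. *)
Lemma normal_form_classification (F : numClosedFieldType) (a b f g h : F) :
  let Q := normal_form (a * b / 2) (f * g / 2 + h ^+ 2 * (a * b / 2) / 4)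
             (f * h / 2) (g * h / 2) in
  [\/ equivalent Q (normal_form 0 0 0 0),
      equivalent Q (normal_form 0 (1 / 2) 0 0),
      equivalent Q (normal_form 0 (1 / 2) (1 / 2) (1 / 2)) |
      equivalent Q (normal_form (1 / 2) (1 / 2) 0 0)] \/
  exists u, equivalent Q (normal_form_C u).
Proof.
move=> Q.
have planeQ c p : equivalent Q (normal_form c p 0 0) ->
    [\/ equivalent Q (normal_form 0 0 0 0),
      equivalent Q (normal_form 0 (1 / 2) 0 0),
      equivalent Q (normal_form 0 (1 / 2) (1 / 2) (1 / 2)) |
      equivalent Q (normal_form (1 / 2) (1 / 2) 0 0)] \/
    exists u, equivalent Q (normal_form_C u).
  move=> Qcp; case: (normal_form_plane c p) => /(equivalent_trans Qcp) H.
  - left; exact: Or41.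
  - left; exact: Or42.
  - left; exact: Or44.
have [h0|h0] := eqVneq h 0.
  by apply: (planeQ (a * b / 2) (f * g / 2));
    rewrite /Q h0 expr0n /= !(mulr0, mul0r) addr0; exact: equivalent_refl.
have [fg|fg] := boolP ((f == 0) && (g == 0)).
  move/andP: fg => [/eqP f0 /eqP g0].
  apply: (planeQ (a * b / 2) (h ^+ 2 * (a * b / 2) / 4)).
  by rewrite /Q f0 g0 !mul0r add0r; exact: equivalent_refl.
have [c0|c0] := eqVneq (a * b / 2) 0.
  have [f0|f0] := eqVneq f 0.
    apply: (planeQ 0 (g * h / 2)).
    rewrite /Q c0 f0 !(mulr0, mul0r) addr0.
    apply: (equivalent_trans (normal_form_swap01 _ _ _ _)).
    exact: normal_form_swap12.
  have [g0|g0] := eqVneq g 0.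
    apply: (planeQ 0 (f * h / 2)).
    by rewrite /Q c0 g0 !(mulr0, mul0r) addr0; exact: normal_form_swap12.
  left; apply: Or43; rewrite /Q c0.
  by apply: (normal_form_scale (al := f^-1) (be := g^-1) (ga := h^-1) (de := 1));
    rewrite ?oner_neq0 ?invr_eq0 //; field; rewrite ?f0 ?g0 ?h0.
right.
have [g0|g0] := eqVneq g 0; last first.
  eexists; rewrite /Q.
  (* Here [f] and [g] are recovered from the coefficients [f h / 2] and [g h / 2]. *)
  have -> : f * g / 2 = 2 * (f * h / 2) * (g * h / 2) / h ^+ 2 by field.
  by apply: (normal_form_C_of_rneq0 _ c0 _ h0);
    rewrite !mulf_neq0 ?invr_eq0 ?pnatr_eq0.
have f0 : f != 0 by move: fg; rewrite g0 eqxx andbT.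
eexists; apply: (equivalent_trans (normal_form_swap01 _ _ _ _)).
have -> : f * g / 2 = 2 * (g * h / 2) * (f * h / 2) / h ^+ 2 by field.
by apply: (normal_form_C_of_rneq0 _ c0 _ h0);
    rewrite !mulf_neq0 ?invr_eq0 ?pnatr_eq0.
Qed.

(** * Inequivalence of the normal forms *)

Lemma normal_form_delta (F : fieldType) (c p q r : F) i :
  normal_form c p q r 'e_i = 'e_i.
Proof.
by apply/rowP; move: i; apply: forall4; apply: forall4;
  rewrite !mxE /= ?expr0n ?expr1n /= ?(mul0r, mulr0) ?(addr0, subr0).
Qed.

(** Polarizing at two basis vectors extracts the coefficient of their mixed monomial in each
    relator. *)
Lemma normal_form_polar_delta (F : fieldType) (c p q r : F) :
  let polar a b := normal_form c p q r ('e_a + 'e_b) -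
    normal_form c p q r 'e_a - normal_form c p q r 'e_b in
  [/\ polar o0 o3 = 0, polar o1 o3 = 0 & polar o2 o3 = 0] /\
  [/\ polar o0 o1 = - (c *: 'e_o2 + p *: 'e_o3), polar o0 o2 = - (q *: 'e_o3) &
      polar o1 o2 = - (r *: 'e_o3)].
Proof.
rewrite /= !normal_form_delta.
by split; split; apply/rowP; apply: forall4; rewrite !mxE /=; ring.
Qed.

(* Comparing the coefficients of the mixed monomials on both sides of the
   hypothesis eliminates [C]. *)
Lemma normal_form_polar (F : fieldType) (Q : 'rV[F]_4 -> 'rV[F]_4) (M C : 'M[F]_4) c p q r :
  (forall v, Q (v *m M) = normal_form c p q r v *m C) ->
  forall j,
  let sq a := Q (row a M) 0 j in
  let polar a b := Q (row a M + row b M) 0 j - sq a - sq b in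
  [/\ polar o0 o3 = 0, polar o1 o3 = 0 & polar o2 o3 = 0] /\
  [/\ polar o0 o1 = - (c * sq o2 + p * sq o3), polar o0 o2 = - (q * sq o3) &
      polar o1 o2 = - (r * sq o3)].
Proof.
move=> H j sq polar; pose N := normal_form c p q r.
have sqE a : sq a = (('e_a : 'rV[F]_4) *m C) 0 j by rewrite /sq rowE H normal_form_delta.
have polarE a b (w : 'rV[F]_4) :
    N ('e_a + 'e_b) - N 'e_a - N 'e_b = w -> polar a b = (w *m C) 0 j.
  move=> <-; rewrite /polar /sq !rowE -mulmxDl !H !mulmxBl.
  by move: (_ *m C) (_ *m C) (_ *m C) => x y z; rewrite !mxE.
have /= [N0 N1] := normal_form_polar_delta c p q r.
split; split; rewrite ?sqE.
- by rewrite (polarE _ _ 0); [rewrite mul0mx mxE | case: N0].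
- by rewrite (polarE _ _ 0); [rewrite mul0mx mxE | case: N0].
- by rewrite (polarE _ _ 0); [rewrite mul0mx mxE | case: N0].
- rewrite (polarE _ _ (- (c *: 'e_o2 + p *: 'e_o3))); last by case: N1.
  by rewrite mulNmx mulmxDl -!scalemxAl; move: (_ *m C) (_ *m C) => x y; rewrite !mxE.
- rewrite (polarE _ _ (- (q *: 'e_o3))); last by case: N1.
  by rewrite mulNmx -!scalemxAl; move: (_ *m C) => x; rewrite !mxE.
- rewrite (polarE _ _ (- (r *: 'e_o3))); last by case: N1.
  by rewrite mulNmx -!scalemxAl; move: (_ *m C) => x; rewrite !mxE.
Qed.

Lemma mulf_eq0_or (F : fieldType) (x y : F) : x * y = 0 -> x = 0 \/ y = 0.
Proof. by move/eqP; rewrite mulf_eq0 => /orP[] /eqP; [left | right]. Qed.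

Lemma eq_of_subr (V : zmodType) (x y a b : V) : a = b -> x - y = a - b -> x = y.
Proof. by move=> ->; rewrite subrr => /subr0_eq. Qed.

Lemma mul_eq0_of_polar (F : numFieldType) (x y : F) :
  (x + y) ^+ 2 - x ^+ 2 - y ^+ 2 = 0 -> x * y = 0.
Proof.
have -> : (x + y) ^+ 2 - x ^+ 2 - y ^+ 2 = 2 * (x * y) by ring.
by case/mulf_eq0_or => // /eqP; rewrite pnatr_eq0.
Qed.

(** Column [j] of [M] is a linear form whose square lies in the span of the relators. No relator has
    a mixed term with [x3], so a form containing [x3] is a multiple of [x3]; its square would then
    bring in the mixed terms of the last relator. The same argument excludes [x2] when [c] is
    nonzero. *)
Lemma square_column (F : numFieldType) (Q : 'rV[F]_4 -> 'rV[F]_4) (M C : 'M[F]_4) c p q r :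
  (forall v, Q (v *m M) = normal_form c p q r v *m C) -> p != 0 \/ r != 0 ->
  forall j, (forall v, Q v 0 j = v 0 j ^+ 2) ->
  M o3 j = 0 /\
  [/\ c != 0 -> M o2 j = 0, M o0 j * M o1 j = 0, M o0 j * M o2 j = 0 &
      M o1 j * M o2 j = 0].
Proof.
move=> H pr j Qj; have := normal_form_polar H j.
rewrite /= !Qj !mxE => -[[h03 h13 h23] [h01 h02 h12]].
move: h03 h13 h23 => /mul_eq0_of_polar h03 /mul_eq0_of_polar h13 /mul_eq0_of_polar h23.
have M3 : M o3 j = 0.
  case/mulf_eq0_or: h23 => // M2; case/mulf_eq0_or: h13 => // M1.
  case/mulf_eq0_or: h03 => // M0; case: pr => nz.
    move: h01; rewrite M0 M1 M2 addr0 expr0n !subr0 mulr0 add0r => /esym/eqP.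
    by rewrite oppr_eq0 mulf_eq0 (negPf nz) expf_eq0 => /eqP.
  move: h12; rewrite M1 M2 addr0 expr0n !subr0 => /esym/eqP.
  by rewrite oppr_eq0 mulf_eq0 (negPf nz) expf_eq0 => /eqP.
move: h01 h02 h12; rewrite M3 expr0n !mulr0 oppr0 addr0 => h01.
move=> /mul_eq0_of_polar h02 /mul_eq0_of_polar h12.
have cM : c != 0 -> M o2 j = 0.
  move=> c0; case/mulf_eq0_or: h12 => // M1; case/mulf_eq0_or: h02 => // M0.
  move: h01; rewrite M0 M1 addr0 expr0n !subr0 => /esym/eqP.
  by rewrite oppr_eq0 mulf_eq0 (negPf c0) expf_eq0 => /eqP.
split=> //; split=> //; apply: mul_eq0_of_polar; rewrite h01.
have [->|/cM ->] := eqVneq c 0; first by rewrite mul0r oppr0.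
by rewrite expr0n mulr0 oppr0.
Qed.

Lemma unitmx_rows_free (F : fieldType) (M : 'M[F]_4) (a b : F) (i j : 'I_4) :
  M \in unitmx -> i != j -> (forall k, a * M i k + b * M j k = 0) -> a = 0 /\ b = 0.
Proof.
move=> uM ij E; have : (a *: 'e_i + b *: 'e_j : 'rV_4) *m M = 0.
  by rewrite mulmxDl -!scalemxAl -!rowE; apply/rowP => k; rewrite !mxE E.
move/(canRL (mulmxK uM)); rewrite mul0mx => /rowP ab; split.
  by have := ab i; rewrite !mxE !eqxx (negPf ij) /= mulr1 mulr0 addr0.
by have := ab j; rewrite !mxE !eqxx eq_sym (negPf ij) /= mulr1 mulr0 add0r.
Qed.

Lemma unitmx_row_neq0 (F : fieldType) (M : 'M[F]_4) (i : 'I_4) :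
  M \in unitmx -> (forall k, M i k = 0) -> False.
Proof.
move=> uM Mi; have [j ij] : exists j, i != j.
  exists (if i == o0 then o1 else o0).
  by have [->|] := eqVneq i o0.
have [] := unitmx_rows_free (a := 1) (b := 0) uM ij; last by move/eqP; rewrite oner_eq0.
by move=> k; rewrite Mi mulr0 mul0r addr0.
Qed.

Lemma normal_form0E (F : fieldType) (c p q r : F) v :
  normal_form c p q r v 0 o0 = v 0 o0 ^+ 2.
Proof. by rewrite mxE. Qed.

Lemma normal_form1E (F : fieldType) (c p q r : F) v :
  normal_form c p q r v 0 o1 = v 0 o1 ^+ 2.
Proof. by rewrite mxE. Qed.

Lemma normal_form2E (F : fieldType) (c p q r : F) v :
  normal_form c p q r v 0 o2 = v 0 o2 ^+ 2 - c * (v 0 o0 * v 0 o1).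
Proof. by rewrite mxE. Qed.

Lemma normal_form02E (F : fieldType) (p q r : F) v :
  normal_form 0 p q r v 0 o2 = v 0 o2 ^+ 2.
Proof. by rewrite normal_form2E mul0r subr0. Qed.

(** All four relators on the left are squares, so no column of [M] could involve [x3]. *)
Lemma normal_form_zero_not_equivalent (F : numFieldType) (c p q r : F) :
  p != 0 \/ r != 0 -> ~ equivalent (normal_form 0 0 0 0) (normal_form c p q r).
Proof.
move=> pr [M [C [uM _ H]]]; apply: (unitmx_row_neq0 (i := o3) uM).
have sq j : (forall v : 'rV[F]_4, normal_form 0 0 0 0 v 0 j = v 0 j ^+ 2) -> M o3 j = 0.
  by move=> hj; have [] := square_column H pr hj.
by apply: forall4; apply: sq => v; rewrite mxE /= ?mul0r ?addr0 ?subr0.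
Qed.

Lemma normal_form_c0_not_equivalent (F : numFieldType) (p q r c' p' q' r' : F) :
  c' != 0 -> p' != 0 \/ r' != 0 ->
  ~ equivalent (normal_form 0 p q r) (normal_form c' p' q' r').
Proof.
move=> c0 pr [M [C [uM _ H]]].
have [M30 [/(_ c0) M20 _ _ _]] := square_column H pr (normal_form0E 0 p q r).
have [M31 [/(_ c0) M21 _ _ _]] := square_column H pr (normal_form1E 0 p q r).
have [M32 [/(_ c0) M22 _ _ _]] := square_column H pr (normal_form02E p q r).
(* The first three columns vanish in rows 2 and 3, so these rows are both multiples of the last
   basis vector and satisfy this relation. *)
have [] := unitmx_rows_free (a := M o3 o3) (b := - M o2 o3) (i := o2) (j := o3) uM isT.
  by apply: forall4; rewrite ?M20 ?M21 ?M22 ?M30 ?M31 ?M32; ring.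
move=> M33 _; apply: (unitmx_row_neq0 (i := o3) uM); exact: forall4.
Qed.

Lemma normal_form_B_not_equivalent_B' (F : numFieldType) (p p' q' r' : F) :
  p' != 0 -> q' != 0 -> r' != 0 ->
  ~ equivalent (normal_form 0 p 0 0) (normal_form 0 p' q' r').
Proof.
move=> p0 q0 r0 [M [C [uM _ H]]].
have pr : p' != 0 \/ r' != 0 by left.
have [M30 [_ a01 a02 a12]] := square_column H pr (normal_form0E 0 p 0 0).
have [M31 [_ b01 b02 b12]] := square_column H pr (normal_form1E 0 p 0 0).
have [M32 _] := square_column H pr (normal_form02E p 0 0).
have d0 : M o3 o3 != 0.
  by apply/eqP => M33; apply: (unitmx_row_neq0 (i := o3) uM); exact: forall4.
have := normal_form_polar H o3.
rewrite /= !mxE /= M30 M31 M32 => -[[h03 h13 h23] [h01 h02 h12]].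
have M3 x : x * M o3 o3 = 0 -> x = 0 by case/mulf_eq0_or => // /eqP; rewrite (negPf d0).
have M03 : M o0 o3 = 0 by apply: M3; apply: mul_eq0_of_polar; rewrite -h03; ring.
have M13 : M o1 o3 = 0 by apply: M3; apply: mul_eq0_of_polar; rewrite -h13; ring.
have M23 : M o2 o3 = 0 by apply: M3; apply: mul_eq0_of_polar; rewrite -h23; ring.
move: h01 h02 h12; rewrite M03 M13 M23 => h01 h02 h12.
have e01 : p * (M o0 o0 * M o1 o1 + M o0 o1 * M o1 o0) = p' * M o3 o3 ^+ 2.
  by apply: (eq_of_subr (esym h01)); ring.
have e02 : p * (M o0 o0 * M o2 o1 + M o0 o1 * M o2 o0) = q' * M o3 o3 ^+ 2.
  by apply: (eq_of_subr (esym h02)); ring.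
have e12 : p * (M o1 o0 * M o2 o1 + M o1 o1 * M o2 o0) = r' * M o3 o3 ^+ 2.
  by apply: (eq_of_subr (esym h12)); ring.
have nz x y : x != 0 -> y = x * M o3 o3 ^+ 2 -> y = 0 -> False.
  by move=> x0 -> /eqP; rewrite mulf_eq0 (negPf x0) expf_eq0 (negPf d0).
(* The left sides of [e01], [e02], [e12] are [p] times the permanents of pairs of rows in columns 0
   and 1. Column 0 has two zeros among its first three rows, and the permanent on those two rows
   vanishes while its right side does not. *)
have [M00|M00] := eqVneq (M o0 o0) 0.
  have [M10|M10] := eqVneq (M o1 o0) 0.
    by apply: (nz _ _ p0 e01); rewrite M00 M10; ring.
  have M20 : M o2 o0 = 0.
    by case/mulf_eq0_or: a12 => // /eqP; rewrite (negPf M10).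
  by apply: (nz _ _ q0 e02); rewrite M00 M20; ring.
have M10 : M o1 o0 = 0 by case/mulf_eq0_or: a01 => // /eqP; rewrite (negPf M00).
have M20 : M o2 o0 = 0 by case/mulf_eq0_or: a02 => // /eqP; rewrite (negPf M00).
by apply: (nz _ _ r0 e12); rewrite M10 M20; ring.
Qed.

(** Columns 0 and 1 involve only [x0] and [x1], so the extra product contributes nothing to mixed
    coefficients with [x2] or [x3], and the reasoning for pure squares carries over. *)
Lemma cone_column (F : numFieldType) (Q : 'rV[F]_4 -> 'rV[F]_4) (M C : 'M[F]_4) c p q r d :
  (forall v, Q (v *m M) = normal_form c p q r v *m C) -> r != 0 ->
  M o2 o0 = 0 -> M o2 o1 = 0 -> M o3 o0 = 0 -> M o3 o1 = 0 ->
  forall j, (forall v, Q v 0 j = v 0 j ^+ 2 - d * (v 0 o0 * v 0 o1)) ->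
  [/\ M o3 j = 0, M o0 j * M o2 j = 0 & M o1 j * M o2 j = 0].
Proof.
move=> H r0 M20 M21 M30 M31 j Qj; have := normal_form_polar H j.
rewrite /= !Qj !mxE M20 M21 M30 M31 => -[[_ h13 h23] [_ h02 h12]].
have {}h13 : M o1 j * M o3 j = 0 by apply: mul_eq0_of_polar; rewrite -h13; ring.
have {}h23 : M o2 j * M o3 j = 0 by apply: mul_eq0_of_polar; rewrite -h23; ring.
have M3 : M o3 j = 0.
  case/mulf_eq0_or: h23 => // M2; case/mulf_eq0_or: h13 => // M1.
  have : r * M o3 j ^+ 2 = 0.
    by apply: (eq_of_subr h12); rewrite M1 M2; ring.
  by case/mulf_eq0_or => [/eqP|/eqP]; [rewrite (negPf r0) | rewrite expf_eq0 => /eqP].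
move: h02 h12; rewrite M3 => h02 h12; split=> //; apply: mul_eq0_of_polar.
  by apply: (eq_of_subr h02); ring.
by apply: (eq_of_subr h12); ring.
Qed.

(** Every relator on the left is a square, possibly minus a multiple of [x0 x1]; together the two
    column lemmas clear the last row of [M]. *)
Lemma normal_form_D1_not_equivalent (F : numFieldType) (c p c' p' q' r' : F) :
  c' != 0 -> r' != 0 ->
  ~ equivalent (normal_form c p 0 0) (normal_form c' p' q' r').
Proof.
move=> c0 r0 [M [C [uM _ H]]]; have pr : p' != 0 \/ r' != 0 by right.
have [M30 [/(_ c0) M20 _ _ _]] := square_column H pr (normal_form0E c p 0 0).
have [M31 [/(_ c0) M21 _ _ _]] := square_column H pr (normal_form1E c p 0 0).
have cone := cone_column H r0 M20 M21 M30 M31.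
apply: (unitmx_row_neq0 (i := o3) uM); apply: forall4 => //.
  by have [|] := cone c o2 => // v; exact: normal_form2E.
have [|] := cone p o3 => // v.
by rewrite mxE /= !mul0r !addr0.
Qed.

Lemma normal_form_C_equivalent (F : numFieldType) (u w : F) :
  equivalent (normal_form_C u) (normal_form_C w) -> u = w \/ u * w = 1.
Proof.
move=> [M [C [uM _ H]]].
have r0 : 1 / 4 != 0 :> F by rewrite mul1r invr_eq0 pnatr_eq0.
have c0 : 1 / 2 != 0 :> F by rewrite mul1r invr_eq0 pnatr_eq0.
have [M30 [/(_ c0) M20 a01 _ _]] :=
  square_column H (or_intror r0) (normal_form0E _ _ _ _).
have [M31 [/(_ c0) M21 b01 _ _]] :=
  square_column H (or_intror r0) (normal_form1E _ _ _ _).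
have [|M32 M022 M122] := cone_column (d := 1 / 2) H r0 M20 M21 M30 M31 (j := o2).
  exact: normal_form2E.
have d0 : M o3 o3 != 0.
  by apply/eqP => M33; apply: (unitmx_row_neq0 (i := o3) uM); exact: forall4.
have g0 : M o2 o2 != 0.
  apply/eqP => M22.
  have [] := unitmx_rows_free (a := M o3 o3) (b := - M o2 o3) (i := o2) (j := o3) uM isT.
    by apply: forall4; rewrite ?M20 ?M21 ?M22 ?M30 ?M31 ?M32; ring.
  by move/eqP; rewrite (negPf d0).
have nz (x y : F) : y != 0 -> x * y = 0 -> x = 0.
  by move=> y0; case/mulf_eq0_or => // /eqP; rewrite (negPf y0).
have M02 := nz _ _ g0 M022; have M12 := nz _ _ g0 M122.
have := normal_form_polar H o2; rewrite /= !mxE /= M02 M12 M20 M21 M30 M31 M32.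
move=> [_ [e01 _ _]].
have := normal_form_polar H o3; rewrite /= !mxE /= M02 M12 M20 M21 M30 M31 M32.
move=> [[f03 f13 f23] [f01 f02 f12]].
have M03 : M o0 o3 = 0 by apply: (nz _ _ d0); apply: mul_eq0_of_polar; rewrite -f03; ring.
have M13 : M o1 o3 = 0 by apply: (nz _ _ d0); apply: mul_eq0_of_polar; rewrite -f13; ring.
have M23 : M o2 o3 = 0 by apply: (nz _ _ d0); apply: mul_eq0_of_polar; rewrite -f23; ring.
move: f01 f02 f12 e01 d0 g0 a01 b01; rewrite M03 M13 M23.
(* Only the entries of a monomial matrix are left, its upper left block being
   diagonal or antidiagonal. *)
move: (M o0 o0) (M o1 o0) (M o0 o1) (M o1 o1) (M o2 o2) (M o3 o3) => a b a' b' ga de.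
move=> f01 f02 f12 e01 de0 ga0 ab ab'.
(* [g1] compares the coefficients of [x0 x1] in the third relator; [g2], [g3], [g4] compare those of
   [x0 x1], [x0 x2], [x1 x2] in the fourth. *)
have g1 : a * b' + a' * b = ga ^+ 2.
  by apply: (mulfI c0); apply: (eq_of_subr (esym e01)); ring.
have g2 : (1 + u) * ga ^+ 2 = (1 + w) * de ^+ 2.
  rewrite -g1; apply: (mulfI (x := 1 / 8)); first by rewrite mul1r invr_eq0 pnatr_eq0.
  by apply: (eq_of_subr (esym f01)); field.
have g3 : (u * a + a') * ga = w * de ^+ 2.
  by apply: (mulfI r0); apply: (eq_of_subr (esym f02)); field.
have g4 : (u * b + b') * ga = de ^+ 2.
  by apply: (mulfI r0); apply: (eq_of_subr (esym f12)); field.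
have [a0|a0] := eqVneq a 0.
  have b0 : b != 0.
    by apply/eqP => b0; move: g1; rewrite a0 b0 mul0r mulr0 addr0 => /esym/eqP;
      rewrite expf_eq0 (negPf ga0).
  have a0' : a' != 0.
    by apply/eqP => a0'; move: g1; rewrite a0 a0' !mul0r addr0 => /esym/eqP;
      rewrite expf_eq0 (negPf ga0).
  have b0' : b' = 0 by case/mulf_eq0_or: ab' => // /eqP; rewrite (negPf a0').
  move: g1 g3 g4 g2; rewrite a0 b0' !(mul0r, mulr0) !(add0r, addr0) => g1 + g4.
  rewrite -g4 => g3 g2.
  have {}g3 : a' = w * u * b by apply: (mulIf ga0); rewrite g3; ring.
  have {}g2 : (1 + u) * ga = (1 + w) * u * b
    by apply: (mulIf ga0); apply: (eq_of_subr g2); ring.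
  (* The ratio [t = ga / b] satisfies [t^2 = u w] and [(1 + u) t = u (1 + w)], hence
     [(t - 1) (t - u) = 0]. The root 1 gives [u w = 1] and the root [u] gives [u = w]. *)
  have /mulf_eq0_or[|] : (b - ga) * (u * b - ga) = 0.
    transitivity (ga ^+ 2 - a' * b); last by rewrite g1 subrr.
    by rewrite g3; apply: (eq_of_subr (congr1 (fun x => - b * x) g2)); ring.
    move/subr0_eq => bga; right; apply: (mulIf (mulf_neq0 b0 b0)).
    transitivity (a' * b); first by rewrite g3; ring.
    by rewrite g1 bga mul1r expr2.
  move/subr0_eq => uga; left; apply: (mulIf b0); apply: (mulIf ga0).
  by rewrite uga -expr2 -g1 g3 -uga; ring.
have b0 : b = 0 by case/mulf_eq0_or: ab => // /eqP; rewrite (negPf a0).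
move: g1 g3 g4 g2; rewrite b0 !(mulr0, add0r, addr0) => g1 + g4; rewrite -g4.
have b0' : b' != 0.
  by apply/eqP => b0'; move: g1; rewrite b0' mulr0 => /esym/eqP; rewrite expf_eq0 (negPf ga0).
have a0' : a' = 0 by case/mulf_eq0_or: ab' => // /eqP; rewrite (negPf b0').
rewrite a0' addr0 => g3 g2.
have {}g3 : u * a = w * b' by apply: (mulIf ga0); rewrite g3; ring.
have {}g2 : (1 + u) * ga = (1 + w) * b'
    by apply: (mulIf ga0); apply: (eq_of_subr g2); ring.
(* Now [t = ga / b'] satisfies [u t^2 = w] and [(1 + u) t = 1 + w], hence [(1 - t) (w - t) = 0]. The
   root 1 gives [u = w] and the root [w] gives [u w = 1]. *)
have /mulf_eq0_or[|] : (b' - ga) * (w * b' - ga) = 0.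
  transitivity (b' * (w * b' - u * a)); last by rewrite g3 subrr mulr0.
  transitivity (w * b' ^+ 2 - u * ga ^+ 2); last by rewrite -g1; ring.
  by apply: (eq_of_subr (congr1 (fun x => ga * x) g2)); ring.
  move/subr0_eq => bga; left; apply: (mulIf b0').
  by rewrite -g3; congr (_ * _); apply: (mulIf b0'); rewrite g1 bga.
move/subr0_eq => wga; right; apply: (mulIf (mulf_neq0 a0 b0')).
transitivity (u * a * (w * b')); first by ring.
by rewrite g3 wga mul1r g1 expr2.
Qed.

(** * The representatives *)

Lemma zero_normal_form (F : numFieldType) :
  equivalent (relators_at (0 : 'M[F]_4)) (normal_form 0 0 0 0).
Proof.
have := normal_form_relators (0 : 'M[F]_4); rewrite /= !mxE /=.
by congr (equivalent _ (normal_form _ _ _ _)); field.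
Qed.

Lemma mxB_normal_form (F : numFieldType) :
  equivalent (relators_at (mxB F)) (normal_form 0 (1 / 2) 0 0).
Proof.
have := normal_form_relators (mxB F); rewrite /= !mxE /=.
by congr (equivalent _ (normal_form _ _ _ _)); field.
Qed.

Lemma mxB'_normal_form (F : numFieldType) :
  equivalent (relators_at (mxB' F)) (normal_form 0 (1 / 2) (1 / 2) (1 / 2)).
Proof.
have := normal_form_relators (mxB' F); rewrite /= !mxE /=.
by congr (equivalent _ (normal_form _ _ _ _)); field.
Qed.

Lemma mxD1_normal_form (F : numFieldType) :
  equivalent (relators_at (mxD1 F)) (normal_form (1 / 2) (1 / 2) 0 0).
Proof.
have := normal_form_relators (mxD1 F); rewrite /= !mxE /=.
by congr (equivalent _ (normal_form _ _ _ _)); field.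
Qed.

(** Completing squares here produces [a = b = h = 1], [f = z + 1/2] and [g = 1/2]. *)
Lemma mxC_normal_form (F : numFieldType) (z : F) :
  equivalent (relators_at (mxC z)) (normal_form_C (z + z + 1)).
Proof.
have := normal_form_relators (mxC z); rewrite /= !mxE /=.
by congr (equivalent _ (normal_form _ _ _ _)); field.
Qed.

Lemma equivalent_to_representative (F : numClosedFieldType) (T : 'M[F]_4) :
  [\/ equivalent (relators_at T) (relators_at (0 : 'M[F]_4)),
      equivalent (relators_at T) (relators_at (mxB F)),
      equivalent (relators_at T) (relators_at (mxB' F)) |
      equivalent (relators_at T) (relators_at (mxD1 F))] \/
  exists z : F, equivalent (relators_at T) (relators_at (mxC z)).
Proof.
have conclude Q (S : 'M[F]_4) : equivalent (relators_at T) Q ->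
    equivalent (relators_at S) Q -> equivalent (relators_at T) (relators_at S).
  by move=> TQ /equivalent_sym; exact: equivalent_trans.
have [a [b [f [g [h TQ]]]]] : exists a b f g h, equivalent (relators_at T)
    (normal_form (a * b / 2) (f * g / 2 + h ^+ 2 * (a * b / 2) / 4)
       (f * h / 2) (g * h / 2)).
  by do 5!eexists; exact: normal_form_relators.
case: (normal_form_classification a b f g h) =>
  [[] /(equivalent_trans TQ) H|[u /(equivalent_trans TQ) H]].
- by left; apply: Or41; exact: conclude H (zero_normal_form _).
- by left; apply: Or42; exact: conclude H (mxB_normal_form _).
- by left; apply: Or43; exact: conclude H (mxB'_normal_form _).
- by left; apply: Or44; exact: conclude H (mxD1_normal_form _).
(* This [z] solves [2 z + 1 = u]. *)
right; exists ((u - 1) / 2); apply: conclude H _.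
have uE : u = (u - 1) / 2 + (u - 1) / 2 + 1 by field.
by rewrite {2}uE; exact: mxC_normal_form.
Qed.

Lemma mxC_inv (F : numClosedFieldType) (z w : F) :
  (z + z + 1) * (w + w + 1) = 1 -> equivalent (relators_at (mxC z)) (relators_at (mxC w)).
Proof.
move=> zw; have z0 : z + z + 1 != 0.
  by apply/eqP => z0; move/eqP: zw; rewrite z0 mul0r eq_sym oner_eq0.
have wE : w + w + 1 = (z + z + 1)^-1 by apply: (mulfI z0); rewrite zw mulfV.
apply: equivalent_trans (mxC_normal_form z) _.
apply: equivalent_trans (normal_form_C_inv z0) _.
by rewrite -wE; exact/equivalent_sym/mxC_normal_form.
Qed.

(** The normal forms separate the five kinds of matrices. Inside the last kind two parameters agree
    or have reciprocal values of [2 z + 1], and the hypothesis on [P] settles the reciprocal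
    case. *)
Lemma representative_inj (F : numFieldType) (P : F -> Prop) (S S' : 'M[F]_4) :
  (forall z w, P z -> P w -> (z + z + 1) * (w + w + 1) = 1 -> z = w) ->
  [\/ S = 0, S = mxB F, S = mxB' F | S = mxD1 F] \/ (exists2 z, P z & S = mxC z) ->
  [\/ S' = 0, S' = mxB F, S' = mxB' F | S' = mxD1 F] \/ (exists2 w, P w & S' = mxC w) ->
  equivalent (relators_at S) (relators_at S') -> S = S'.
Proof.
move=> injP.
have half0 : 1 / 2 != 0 :> F by rewrite mul1r invr_eq0 pnatr_eq0.
have quarter0 : 1 / 4 != 0 :> F by rewrite mul1r invr_eq0 pnatr_eq0.
have differ (A B : 'M[F]_4) Q Q' : equivalent (relators_at A) Q ->
    equivalent (relators_at B) Q' -> ~ equivalent Q Q' ->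
    ~ equivalent (relators_at A) (relators_at B) /\
    ~ equivalent (relators_at B) (relators_at A).
  move=> AQ BQ nQ; have nAB : ~ equivalent (relators_at A) (relators_at B).
    move=> AB; apply: nQ; apply: equivalent_trans (equivalent_sym AQ) _.
    exact: equivalent_trans AB BQ.
  by split=> // /equivalent_sym.
have [zero_B B_zero] := differ _ _ _ _ (zero_normal_form F) (mxB_normal_form F)
  (normal_form_zero_not_equivalent (or_introl half0)).
have [zero_B' B'_zero] := differ _ _ _ _ (zero_normal_form F) (mxB'_normal_form F)
  (normal_form_zero_not_equivalent (or_introl half0)).
have [zero_D1 D1_zero] := differ _ _ _ _ (zero_normal_form F) (mxD1_normal_form F)
  (normal_form_zero_not_equivalent (or_introl half0)).
have zero_C z := differ _ _ _ _ (zero_normal_form F) (mxC_normal_form z)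
  (normal_form_zero_not_equivalent (or_intror quarter0)).
have [B_B' B'_B] := differ _ _ _ _ (mxB_normal_form F) (mxB'_normal_form F)
  (normal_form_B_not_equivalent_B' half0 half0 half0).
have [B_D1 D1_B] := differ _ _ _ _ (mxB_normal_form F) (mxD1_normal_form F)
  (normal_form_c0_not_equivalent half0 (or_introl half0)).
have B_C z := differ _ _ _ _ (mxB_normal_form F) (mxC_normal_form z)
  (normal_form_c0_not_equivalent half0 (or_intror quarter0)).
have [B'_D1 D1_B'] := differ _ _ _ _ (mxB'_normal_form F) (mxD1_normal_form F)
  (normal_form_c0_not_equivalent half0 (or_introl half0)).
have B'_C z := differ _ _ _ _ (mxB'_normal_form F) (mxC_normal_form z)
  (normal_form_c0_not_equivalent half0 (or_intror quarter0)).
have D1_C z := differ _ _ _ _ (mxD1_normal_form F) (mxC_normal_form z)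
  (normal_form_D1_not_equivalent half0 quarter0).
move=> [[->|->|->|->]|[z Pz ->]] [[->|->|->|->]|[w Pw ->]] SS'.
- by [].
- by case: (zero_B SS').
- by case: (zero_B' SS').
- by case: (zero_D1 SS').
- by case: (proj1 (zero_C w) SS').
- by case: (B_zero SS').
- by [].
- by case: (B_B' SS').
- by case: (B_D1 SS').
- by case: (proj1 (B_C w) SS').
- by case: (B'_zero SS').
- by case: (B'_B SS').
- by [].
- by case: (B'_D1 SS').
- by case: (proj1 (B'_C w) SS').
- by case: (D1_zero SS').
- by case: (D1_B SS').
- by case: (D1_B' SS').
- by [].
- by case: (proj1 (D1_C w) SS').
- by case: (proj2 (zero_C z) SS').
- by case: (proj2 (B_C z) SS').
- by case: (proj2 (B'_C z) SS').
- by case: (proj2 (D1_C z) SS').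
have : equivalent (normal_form_C (z + z + 1)) (normal_form_C (w + w + 1)).
  apply: equivalent_trans (equivalent_sym (mxC_normal_form z)) _.
  exact: equivalent_trans SS' (mxC_normal_form w).
case/normal_form_C_equivalent => [zw|/(injP _ _ Pz Pw) -> //].
congr mxC; apply: (mulfI (x := 2)); first by rewrite pnatr_eq0.
by apply: (eq_of_subr zw); ring.
Qed.

(** * A fundamental domain for inversion *)

Definition half_disk (R : rcfType) (u : R[i]) : Prop :=
  `|u| < 1 \/ (`|u| = 1 /\ 0 <= complex.Im u).

(** The map [z -> 2 z + 1] sends the disk of radius 1/2 about -1/2 to the unit disk and preserves
    the sign of the imaginary part. *)
Lemma in_UE (R : realType) (z : R[i]) : in_U z <-> half_disk (z + z + 1).
Proof.
have zE : `|z + z + 1| = 2 * `|z + 2^-1|.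
  have -> : z + z + 1 = 2 * (z + 2^-1) by field.
  by rewrite normrM normr_nat.
have two0 : (2 : R[i]) != 0 by rewrite pnatr_eq0.
have ImE : (0 <= complex.Im (z + z + 1)) = (0 <= complex.Im z).
  by case: z {zE} => a b /=; rewrite addr0 -mulr2n pmulrn_lge0.
have ltE : (2 * `|z + 2^-1| < 1) = (`|z + 2^-1| < 2^-1).
  by rewrite -(ltr_pM2l (ltr0Sn R[i] 1) `|_|) mulfV.
rewrite /in_U /half_disk zE ImE ltE.
suff -> : (2 * `|z + 2^-1| = 1) <-> (`|z + 2^-1| = 2^-1) by [].
split=> [e|->]; last by rewrite mulfV.
by apply: (mulfI two0); rewrite e mulfV.
Qed.

Lemma unit_circle_inv (R : rcfType) (u w : R[i]) : `|u| = 1 -> u * w = 1 -> w = conjc u.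
Proof.
move=> u1 uw; have uu : u * conjc u = 1.
  have := add_Re2_Im2 u; rewrite u1 expr1n => /eqP.
  rewrite eq_complex /= => /andP[/eqP e _].
  case: u e {u1 uw} => a b /= e; apply/eqP; rewrite eq_complex /=.
  by rewrite mulrN opprK -!expr2 e eqxx mulrN [b * a]mulrC addNr /=.
by rewrite -[RHS]mulr1 -uw mulrA [_ * u]mulrC uu mul1r.
Qed.

(** Inversion sends the exterior of the unit disk inside, and on the circle it is conjugation, which
    exchanges the two half circles. *)
Lemma half_disk_inv (R : rcfType) (u : R[i]) : half_disk u \/ u != 0 /\ half_disk u^-1.
Proof.
have [|u1|u1] := real_ltgtP (normr_real u) (real1 R[i]).
- by left; left.
- have u0 : u != 0 by rewrite -normr_gt0; apply: lt_trans u1.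
  by right; split=> //; left; rewrite normfV invf_lt1 // normr_gt0.
have u0 : u != 0 by rewrite -normr_gt0 u1.
have [Im0|Im0] := leP 0 (complex.Im u); first by left; right.
right; split=> //; right; rewrite normfV u1 invr1; split=> //.
rewrite (unit_circle_inv u1 (mulfV u0)).
by case: u Im0 {u1 u0} => a b /= b0; rewrite oppr_ge0 ltW.
Qed.

(** Two norms at most 1 with product 1 both equal 1, so [w] is the conjugate of [u]; as both
    imaginary parts are nonnegative, they vanish. *)
Lemma half_disk_inj (R : rcfType) (u w : R[i]) :
  half_disk u -> half_disk w -> u * w = 1 -> u = w.
Proof.
move=> Du Dw uw.
have nuw : `|u| * `|w| = 1 by rewrite -normrM uw normr1.
have le1 (x : R[i]) : half_disk x -> `|x| <= 1 by case=> [/ltW|[-> _]].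
have not_lt (x y : R[i]) : `|x| * `|y| = 1 -> half_disk y -> `|x| < 1 -> False.
  move=> xy /le1 y1 x1; have := ler_wpM2l (normr_ge0 x) y1.
  by rewrite xy mulr1 => /(lt_le_trans x1); rewrite ltxx.
case: (Du) => [/(not_lt _ _ nuw Dw) //|[u1 Imu]].
case: (Dw) => [|[w1 Imw]]; first by move/(not_lt w u); rewrite mulrC => /(_ nuw Du).
have := unit_circle_inv u1 uw.
case: u w Imu Imw {Du Dw uw nuw u1 w1} => a b [c d] /= b0 d0 [-> E].
move: d0; rewrite E oppr_ge0 => b0'.
have -> : b = 0 by apply/eqP; rewrite eq_le b0' b0.
by rewrite oppr0.
Qed.

Theorem theorem3p7 (R : realType) :
  (forall S : 'M[R[i]]_4, representative S -> strictly_lower_triangular S) /\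
  (forall T : 'M[R[i]]_4, strictly_lower_triangular T ->
     exists! S : 'M[R[i]]_4, representative S /\ graded_iso T S).
Proof.
have nz2 : 2 != 0 :> R[i] by rewrite pnatr_eq0.
split.
  by move=> S [[->|->|->|->]|[z _ ->]]; do 2!apply: forall4; rewrite !mxE.
move=> T _.
have [S [repS TS]] : exists S : 'M[R[i]]_4,
    representative S /\ equivalent (relators_at T) (relators_at S).
  case: (equivalent_to_representative T) => [[] H|[z H]].
  - by exists 0; split=> //; left; apply: Or41.
  - by exists (mxB _); split=> //; left; apply: Or42.
  - by exists (mxB' _); split=> //; left; apply: Or43.
  - by exists (mxD1 _); split=> //; left; apply: Or44.
  have [Dz|[z0 Dz]] := half_disk_inv (z + z + 1).
    by exists (mxC z); split=> //; right; exists z => //; apply/in_UE.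
  (* When [2 z + 1] lies outside the domain, [w] is the parameter with [2 w + 1] equal to its
     inverse. *)
  pose w := ((z + z + 1)^-1 - 1) / 2.
  have wE : w + w + 1 = (z + z + 1)^-1 by rewrite /w; field.
  exists (mxC w); split; first by right; exists w => //; apply/in_UE; rewrite wE.
  by apply: equivalent_trans H _; apply: mxC_inv; rewrite wE mulfV.
exists S; split=> [|S' [repS' /(graded_iso_equivalent _ _ nz2) TS']].
  by split=> //; apply/graded_iso_equivalent.
have SS' := equivalent_trans (equivalent_sym TS) TS'.
apply: representative_inj repS repS' SS' => z w /in_UE Dz /in_UE Dw zw.
have {}zw := half_disk_inj Dz Dw zw.
by apply: (mulfI nz2); apply: (eq_of_subr zw); ring.
Qed.
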